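(* Let $V$ be a real vector space, let $F$ be a geometric mean closed, semiprime $f$-algebra, let $T\colon V\times V\to F$ be a vector semi-inner product, and let $u\in F^+$. Define $\|x\|^T_u:=T(x,x)\boxtimes u$ for $x\in V$. Then for all $x,y\in V$, \[ (\|x+y\|^T_u)^2\le(\|x\|^T_u+\|y\|^T_u)^2-\inf_{\lambda\in\mathbb{R}\setminus\{0\}}\{|\lambda|^{-1}(\|\lambda x-y\|^T_u)^2\}\le(\|x\|^T_u+\|y\|^T_u)^2 \] (where the infimum exists in $F$). Moreover, the equality \[ (\|x+y\|^T_u)^2=(\|x\|^T_u+\|y\|^T_u)^2-\inf_{\lambda\in\mathbb{R}\setminus\{0\}}\{|\lambda|^{-1}(\|\lambda x-y\|^T_u)^2\} \] holds if and only if $T(x,y)u\in F^+$.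
   Context: All vector spaces are over $\mathbb{R}$ and all vector lattices are Archimedean; $F^+=\{x\in F:x\ge0\}$. An $f$-algebra is a vector lattice $F$ with an associative bilinear multiplication (written by juxtaposition, $a^2=aa$) such that $xy\in F^+$ for $x,y\in F^+$, and $\inf\{x,y\}=0$ implies $\inf\{xz,y\}=\inf\{x,yz\}=0$ for all $z\in F^+$. It is semiprime if it has no nonzero nilpotent elements. A vector lattice $F$ is geometric mean closed if $\inf\{\theta u+\theta^{-1}v:\theta\in(0,\infty)\}$ exists in $F$ for all $u,v\in F^+$, and then $u\boxtimes v:=2^{-1}\inf\{\theta u+\theta^{-1}v:\theta\in(0,\infty)\}$. A map $T\colon V\times V\to F$ is a vector semi-inner product if it is bilinear, symmetric ($T(x,y)=T(y,x)$), and satisfies $T(x,x)\ge 0$ for all $x\in V$. *)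

(* Defs.v *)
From HB Require Import structures.
From mathcomp Require Import all_boot all_order all_algebra.
From mathcomp Require Import reals.
From Stdlib Require Import ClassicalEpsilon.
Set Implicit Arguments. Unset Strict Implicit. Unset Printing Implicit Defensive.
Import Order.TTheory GRing.Theory Num.Theory.
Local Open Scope ring_scope.

Section Defs.
Variables (R : realType) (F : lmodType R) (le : F -> F -> Prop).

Definition is_inf (S : F -> Prop) (m : F) : Prop :=
  (forall s, S s -> le m s) /\ (forall l, (forall s, S s -> le l s) -> le l m).
Definition is_sup (S : F -> Prop) (m : F) : Prop :=
  (forall s, S s -> le s m) /\ (forall l, (forall s, S s -> le s l) -> le m l).

Definition pair_set (x y : F) : F -> Prop := fun w => w = x \/ w = y.

Definition is_vector_lattice : Prop :=
  [/\ (forall x, le x x),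
      (forall x y, le x y -> le y x -> x = y) &
      (forall x y z, le x y -> le y z -> le x z)] /\
  [/\ (forall x y z, le x y -> le (x + z) (y + z)),
      (forall (a : R) x y, 0 <= a -> le x y -> le (a *: x) (a *: y)),
      (forall x y, (exists m, is_sup (pair_set x y) m) /\
                   (exists m, is_inf (pair_set x y) m)) &
      (forall x y, le 0 x -> (forall n : nat, le (n%:R *: x) y) -> x = 0)].

Definition is_f_algebra (mul : F -> F -> F) : Prop :=
  [/\ (forall x y z, mul x (mul y z) = mul (mul x y) z),
      (forall (a : R) x y z, mul (a *: x + y) z = a *: mul x z + mul y z),
      (forall (a : R) x y z, mul z (a *: x + y) = a *: mul z x + mul z y),
      (forall x y, le 0 x -> le 0 y -> le 0 (mul x y)) &
      (forall x y z, is_inf (pair_set x y) 0 -> le 0 z ->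
          is_inf (pair_set (mul x z) y) 0 /\ is_inf (pair_set x (mul y z)) 0)].

(* fpow mul x n = x^(n+1) *)
Definition fpow (mul : F -> F -> F) (x : F) (n : nat) : F := iter n (mul x) x.

Definition semiprime (mul : F -> F -> F) : Prop :=
  forall x n, fpow mul x n = 0 -> x = 0.

Definition gm_set (u v : F) : F -> Prop :=
  fun w => exists theta : R, 0 < theta /\ w = theta *: u + theta^-1 *: v.

Definition gm_closed : Prop :=
  forall u v, le 0 u -> le 0 v -> exists m, is_inf (gm_set u v) m.

(* a chosen infimum (the infimum, when it exists and le is antisymmetric) *)
Definition inf_of (S : F -> Prop) : F :=
  epsilon (inhabits 0) (fun m => is_inf S m).

Definition boxtimes (u v : F) : F := 2^-1 *: inf_of (gm_set u v).

Variable V : lmodType R.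
Definition is_vsip (T : V -> V -> F) : Prop :=
  [/\ (forall (a : R) x y z, T (a *: x + y) z = a *: T x z + T y z),
      (forall (a : R) x y z, T z (a *: x + y) = a *: T z x + T z y),
      (forall x y, T x y = T y x) &
      (forall x, le 0 (T x x))].

Definition Tnorm (T : V -> V -> F) (u : F) (x : V) : F := boxtimes (T x x) u.
End Defs.

(* Main.v *)
From HB Require Import structures.
Require Import Defs.
From mathcomp Require Import all_boot all_order all_algebra.
From mathcomp Require Import reals ring.
From Stdlib Require Import ClassicalEpsilon.
Set Implicit Arguments. Unset Strict Implicit. Unset Printing Implicit Defensive.
Import Order.TTheory GRing.Theory Num.Theory.
Local Open Scope ring_scope.

(* Right multiplications by positive elements are orthomorphisms, and
   orthomorphisms of an Archimedean vector lattice commute; with semiprimeness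
   this makes the multiplication commutative. The geometric mean then satisfies
   [(a boxtimes b)^2 = a b], so [p = ||x||] and [q = ||y||] satisfy [p^2 = T(x,x) u] and
   [q^2 = T(y,y) u]. With [c = T(x,y) u], the infimum over [lam] splits according
   to the sign of [lam] into [inf (t p^2 + t^-1 q^2) - 2 |c| = 2 p q - 2 |c|], by
   uniqueness of positive square roots. Everything is then read off from
   [||x + y||^2 = p^2 + 2 c + q^2] and [(p + q)^2 = p^2 + 2 p q + q^2].
   As no functional representation is available, pointwise arguments (choosing
   the optimal parameter at each point) are replaced by disjointness arguments
   along the grid [k e], closed by the Archimedean property. *)

(** * Commutative algebras and their unitization *)

Record comm_mul (R : realType) (F : lmodType R) := CommMul {
  cmul :> F -> F -> F;
  cmulA : forall x y z, cmul x (cmul y z) = cmul (cmul x y) z;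
  cmulC : forall x y, cmul x y = cmul y x;
  cmulL : forall (a : R) x y z, cmul (a *: x + y) z = a *: cmul x z + cmul y z }.

(* Adjoining a unit to a commutative algebra makes the tactic [ring] available
   for identities of the algebra and, with the zero product, for identities of
   the underlying module. *)
Definition unitization (R : realType) (F : lmodType R) (m : comm_mul F) : Type :=
  (R * F)%type.

Section Unitization.
Variables (R : realType) (F : lmodType R) (m : comm_mul F).
Local Notation U := (unitization m).

Lemma cmulDl x y z : m (x + y) z = m x z + m y z.
Proof. by rewrite -[x in LHS]scale1r cmulL scale1r. Qed.

Lemma cmul0l z : m 0 z = 0.
Proof. by apply: (addIr (m 0 z)); rewrite -cmulDl !add0r. Qed.

Lemma cmulZl a x z : m (a *: x) z = a *: m x z.
Proof. by rewrite -[_ *: x]addr0 cmulL cmul0l addr0. Qed.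

Lemma cmulDr x y z : m z (x + y) = m z x + m z y.
Proof. by rewrite !(cmulC _ z) cmulDl. Qed.

Lemma cmulZr a x z : m z (a *: x) = a *: m z x.
Proof. by rewrite !(cmulC _ z) cmulZl. Qed.

HB.instance Definition _ := GRing.Zmodule.copy U (R * F)%type.

Let one : U := (1, 0).
Let umul (p q : U) : U := (p.1 * q.1, p.1 *: q.2 + q.1 *: p.2 + m p.2 q.2).

Let umulC : commutative umul.
Proof.
by move=> p q; rewrite /umul mulrC cmulC [_ *: _ + _ *: _]addrC.
Qed.

Let umulA : associative umul.
Proof.
move=> [a x] [b y] [c z]; rewrite /umul /=; congr pair; first exact: mulrA.
rewrite !scalerDr !cmulDl !cmulDr !cmulZl !cmulZr !scalerA cmulA.
by rewrite (mulrC c a) (mulrC c b) !addrA [LHS](AC 7%AC (1*2*4*6*3*5*7)%AC).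
Qed.

Let umul1 : left_id one umul.
Proof.
by move=> [a x]; rewrite /umul /= mul1r scale1r scaler0 cmul0l !addr0.
Qed.

Let umulD : left_distributive umul +%R.
Proof.
move=> [a x] [b y] [c z]; rewrite /umul /=; congr pair; first exact: mulrDl.
by rewrite scalerDl scalerDr cmulDl [LHS](AC (2*2*2)%AC (1*3*5*(2*4*6))%AC).
Qed.

Let one_neq0 : one != 0.
Proof. by apply/eqP => /(congr1 fst)/eqP; rewrite oner_eq0. Qed.

HB.instance Definition _ :=
  GRing.Zmodule_isComNzRing.Build U umulA umulC umul1 umulD one_neq0.

Definition uinj (x : F) : U := (0, x).
Definition uscal (a : R) : U := (a, 0).

Lemma uinj_inj : injective uinj. Proof. by move=> x y []. Qed.

Let uscal_zmod : zmod_morphism uscal.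
Proof. by move=> a b; congr pair; rewrite /= subr0. Qed.

Let uscal_monoid : monoid_morphism uscal.
Proof.
split=> // a b; congr pair => /=.
by rewrite !scaler0 cmul0l !addr0.
Qed.

HB.instance Definition _ := GRing.isZmodMorphism.Build R U uscal uscal_zmod.
HB.instance Definition _ := GRing.isMonoidMorphism.Build R U uscal uscal_monoid.

Lemma uinj0 : uinj 0 = 0. Proof. by []. Qed.

Lemma uinjD x y : uinj (x + y) = uinj x + uinj y.
Proof. by congr pair; rewrite /= addr0. Qed.

Lemma uinjN x : uinj (- x) = - uinj x.
Proof. by congr pair; rewrite /= oppr0. Qed.

Lemma uinjZ a x : uinj (a *: x) = uscal a * uinj x.
Proof. by congr pair; rewrite /= ?mulr0 // scale0r cmul0l !addr0. Qed.

Lemma uinjM x y : uinj (m x y) = uinj x * uinj y.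
Proof. by congr pair; rewrite /= ?mulr0 // !scale0r !add0r. Qed.

Definition uinjE := (uinj0, uinjD, uinjN, uinjZ, uinjM).

End Unitization.

Lemma zero_mulL (R : realType) (F : lmodType R) (a : R) (x y z : F) :
  0 = a *: 0 + 0 :> F.
Proof. by rewrite scaler0 addr0. Qed.

Definition zero_mul (R : realType) (F : lmodType R) : comm_mul F :=
  @CommMul R F (fun _ _ => 0) (fun _ _ _ => erefl) (fun _ _ => erefl)
    (@zero_mulL R F).

Ltac alg_ring m := apply: (@uinj_inj _ _ m); rewrite !uinjE; ring.
Ltac lin_ring :=
  apply: (@uinj_inj _ _ (zero_mul _)); rewrite !uinjE; ring.

(** * Positive parts and disjointness in an Archimedean vector lattice *)

Section VectorLattice.
Variables (R : realType) (F : lmodType R) (le : F -> F -> Prop).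
Hypothesis hVL : is_vector_lattice le.

Lemma vl_refl x : le x x.
Proof. by case: hVL => -[]. Qed.

Lemma vl_anti x y : le x y -> le y x -> x = y.
Proof. by case: hVL => -[? + ?] _; apply. Qed.

Lemma vl_trans y x z : le x y -> le y z -> le x z.
Proof. by case: hVL => -[? ? +] _; apply. Qed.

Lemma vl_leD2r z x y : le x y -> le (x + z) (y + z).
Proof. by case: hVL => _ [+ _ _ _]; apply. Qed.

Lemma vl_leZ (a : R) x y : 0 <= a -> le x y -> le (a *: x) (a *: y).
Proof. by case: hVL => _ [_ + _ _]; apply. Qed.

Lemma vl_arch x y : le 0 x -> (forall n : nat, le (n%:R *: x) y) -> x = 0.
Proof. by case: hVL => _ [_ _ _ +]; apply. Qed.

Lemma subge0 x y : le x y -> le 0 (y - x).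
Proof. by move/(vl_leD2r (- x)); rewrite subrr. Qed.

(** Inequalities are proved by exhibiting the difference as a sum [e] of nonnegative terms, which
    leaves an identity for [ring]. *)
Lemma le_of_sub x y e : le 0 e -> y - x = e -> le x y.
Proof. by move=> he hd; move/(vl_leD2r x): he; rewrite -hd add0r subrK. Qed.

Lemma addge0 x y : le 0 x -> le 0 y -> le 0 (x + y).
Proof. by move=> hx /(vl_leD2r x); rewrite add0r addrC; apply: vl_trans. Qed.

Lemma scalege0 (a : R) x : 0 <= a -> le 0 x -> le 0 (a *: x).
Proof. by move=> ha /(vl_leZ ha); rewrite scaler0. Qed.

Lemma le_addr x y : le 0 y -> le x (x + y).
Proof. by move=> /le_of_sub; apply; rewrite addrAC subrr add0r. Qed.

Lemma le_addl x y : le 0 y -> le x (y + x).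
Proof. by rewrite addrC; apply: le_addr. Qed.

Lemma le0_anti x : le 0 x -> le x 0 -> x = 0.
Proof. by move=> h0 h1; apply: vl_anti. Qed.

Lemma vl_arch_eps x y : le 0 x -> le 0 y ->
  (forall e : R, 0 < e -> le x (e *: y)) -> x = 0.
Proof.
move=> hx hy h; apply: (vl_arch (y := y) hx) => -[|n]; first by rewrite scale0r.
have n0 : 0 < n.+1%:R :> R by rewrite ltr0n.
have /(vl_leZ (ltW n0)) := h n.+1%:R^-1 ltac:(by rewrite invr_gt0).
by rewrite scalerA divff ?scale1r // gt_eqF.
Qed.

Definition ppart x : F := epsilon (inhabits 0) (is_sup le (pair_set x 0)).

Lemma ppartP x : is_sup le (pair_set x 0) (ppart x).
Proof.
apply: epsilon_spec; case: hVL => _ [_ _ + _] => /(_ x 0) [+ _].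
by case=> s hs; exists s.
Qed.

Lemma ppart_ge0 x : le 0 (ppart x).
Proof. by case: (ppartP x) => + _; apply; right. Qed.

Lemma le_ppart x : le x (ppart x).
Proof. by case: (ppartP x) => + _; apply; left. Qed.

Lemma ppart_le x y : le 0 y -> le x y -> le (ppart x) y.
Proof. by move=> h0 hx; case: (ppartP x) => _; apply=> s [] ->. Qed.

Lemma ppart_le0 x : le x 0 -> ppart x = 0.
Proof.
by move=> h; apply: le0_anti (ppart_ge0 x) (ppart_le (vl_refl 0) h).
Qed.

Lemma ppart_eq0 x : ppart x = 0 -> le x 0.
Proof. by move=> <-; apply: le_ppart. Qed.

(** Serves to eliminate negative parts, so that linear identities contain [ppart x] as their only
    lattice term. *)
Lemma ppartN x : ppart (- x) = ppart x - x.
Proof.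
apply: vl_anti.
  apply: ppart_le; first exact: subge0 (le_ppart x).
  apply: (le_of_sub (ppart_ge0 x)); lin_ring.
have : le (ppart x) (x + ppart (- x)).
  apply: ppart_le.
    apply: (le_of_sub (subge0 (le_ppart (- x)))); lin_ring.
  exact: le_addr (ppart_ge0 _).
move/subge0 => h; apply: (le_of_sub h); lin_ring.
Qed.

Lemma ppart_decomp x : x = ppart x - ppart (- x).
Proof. by rewrite ppartN opprB addrC subrK. Qed.

Definition vabs x : F := ppart x + ppart (- x).

Lemma vabs_ge0 x : le 0 (vabs x).
Proof. exact: addge0 (ppart_ge0 x) (ppart_ge0 (- x)). Qed.

Lemma le_vabs x : le x (vabs x).
Proof. exact: vl_trans (le_ppart x) (le_addr _ (ppart_ge0 (- x))). Qed.

Lemma le_vabsN x : le (- x) (vabs x).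
Proof. exact: vl_trans (le_ppart (- x)) (le_addl _ (ppart_ge0 x)). Qed.

Definition disj x y := is_inf le (pair_set x y) 0.

Lemma disj_ge0l x y : disj x y -> le 0 x.
Proof. by case=> + _; apply; left. Qed.

Lemma disj_sym x y : disj x y -> disj y x.
Proof.
case=> h1 h2; split=> [s hs|l hl]; first by apply: h1; case: hs; [right|left].
by apply: h2 => s hs; apply: hl; case: hs; [right|left].
Qed.

Lemma disj_ge0r x y : disj x y -> le 0 y.
Proof. by move/disj_sym/disj_ge0l. Qed.

Lemma disj_le0 x y l : disj x y -> le l x -> le l y -> le l 0.
Proof. by case=> _ h h1 h2; apply: h => s [] ->. Qed.

(** A lower bound [l] of [x] and [y] may be replaced by its positive part, which is still below
    both. *)
Lemma disjP x y : le 0 x -> le 0 y ->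
  (forall j, le 0 j -> le j x -> le j y -> j = 0) -> disj x y.
Proof.
move=> hx hy h; split=> [s [] -> //|l hl].
have lx : le l x by apply: hl; left.
have ly : le l y by apply: hl; right.
by apply: ppart_eq0; apply: h; [exact: ppart_ge0 | exact: ppart_le..].
Qed.

Lemma disj_eq0 x y j : disj x y -> le 0 j -> le j x -> le j y -> j = 0.
Proof. by move=> h h0 h1 h2; apply: le0_anti (disj_le0 h h1 h2). Qed.

Lemma disj_le x y x' : disj x y -> le 0 x' -> le x' x -> disj x' y.
Proof.
move=> h h0 hx; apply: disjP => //; first exact: disj_ge0r h.
by move=> j j0 jx jy; apply: (disj_eq0 h) => //; apply: vl_trans hx.
Qed.

Lemma disj0 x : le 0 x -> disj x 0.
Proof.
by move=> h; apply: disjP => //; [exact: vl_refl | move=> j *; apply: le0_anti].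
Qed.

Lemma disjxx x : disj x x -> x = 0.
Proof.
by move=> h; apply: (disj_eq0 h); [exact: disj_ge0l h | exact: vl_refl..].
Qed.

Lemma disjD x y z : disj x y -> disj x z -> disj x (y + z).
Proof.
move=> hy hz; apply: disjP; first exact: disj_ge0l hy.
  by apply: addge0; [exact: disj_ge0r hy | exact: disj_ge0r hz].
move=> j j0 jx jyz; apply: (disj_eq0 hz) => //.
suff /subge0 h : le (j - z) 0 by apply: (le_of_sub h); lin_ring.
apply: (disj_le0 hy).
  apply: vl_trans jx; apply: (le_of_sub (disj_ge0r hz)); lin_ring.
move/subge0: jyz => h; apply: (le_of_sub h); lin_ring.
Qed.

Lemma disjZ (a : R) x y : 0 <= a -> disj x y -> disj x (a *: y).
Proof.
move=> a0 h; apply: disjP; first exact: disj_ge0l h.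
  exact: scalege0 a0 (disj_ge0r h).
move=> j j0 jx jy.
(* The factor [1 + a] bounds both [1] and [a], so [(1 + a)^-1 *: j] lies below [x] and [y] at
   once. *)
have a1 : 0 < 1 + a by rewrite ltr_wpDr.
have hV : 0 <= (1 + a)^-1 by rewrite invr_ge0 ltW.
suff : (1 + a)^-1 *: j = 0.
  by move/(congr1 ( *:%R (1 + a))); rewrite scaler0 scalerA divff ?scale1r ?gt_eqF.
apply: (disj_eq0 h); first exact: scalege0.
  have -> : x = (1 + a)^-1 *: ((1 + a) *: x).
    by rewrite scalerA mulVf ?scale1r ?gt_eqF.
  apply: vl_leZ => //; apply: vl_trans jx _.
  apply: (le_of_sub (scalege0 a0 (disj_ge0l h))); lin_ring.
have -> : y = (1 + a)^-1 *: ((1 + a) *: y).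
  by rewrite scalerA mulVf ?scale1r ?gt_eqF.
apply: vl_leZ => //; apply: vl_trans jy _.
apply: (le_of_sub (disj_ge0r h)); lin_ring.
Qed.

Lemma disj_ppart x : disj (ppart x) (ppart (- x)).
Proof.
apply: disjP; [exact: ppart_ge0..|move=> j j0 jp]; rewrite ppartN => jn.
apply: le0_anti => //.
have /subge0 h : le (ppart x) (ppart x - j).
  apply: ppart_le; first exact: subge0.
  move/subge0: jn => h; apply: (le_of_sub h); lin_ring.
apply: (le_of_sub h); lin_ring.
Qed.

(** The element [j - x] lies below both [j] and [q], hence below [0]. *)
Lemma disj_le_add j q x : disj j q -> le 0 x -> le j (q + x) -> le j x.
Proof.
move=> h x0 /subge0 hj.
suff /subge0 h' : le (j - x) 0 by apply: (le_of_sub h'); lin_ring.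
apply: (disj_le0 h); first by apply: (le_of_sub x0); lin_ring.
apply: (le_of_sub hj); lin_ring.
Qed.

(** * Positive orthomorphisms and their commutation *)

Definition orthomorphism (A : F -> F) :=
  [/\ forall (a : R) x y, A (a *: x + y) = a *: A x + A y,
      forall x, le 0 x -> le 0 (A x) &
      forall x y, disj x y -> disj (A x) y].

Section Orthomorphism.
Variable A : F -> F.
Hypothesis hA : orthomorphism A.

Lemma orthD x y : A (x + y) = A x + A y.
Proof. by case: hA => h _ _; rewrite -[x in LHS]scale1r h scale1r. Qed.

Lemma orth0 : A 0 = 0.
Proof. by apply: (addIr (A 0)); rewrite -orthD !add0r. Qed.

Lemma orthZ a x : A (a *: x) = a *: A x.
Proof. by case: hA => h _ _; rewrite -[_ *: x]addr0 h orth0 addr0. Qed.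

Lemma orthB x y : A (x - y) = A x - A y.
Proof. by rewrite orthD -scaleN1r orthZ scaleN1r. Qed.

Lemma orth_ge0 x : le 0 x -> le 0 (A x).
Proof. by case: hA => _ + _; apply. Qed.

Lemma orth_disj x y : disj x y -> disj x (A y).
Proof. by case: hA => _ _ h /disj_sym/h/disj_sym. Qed.

Lemma orth_le x y : le x y -> le (A x) (A y).
Proof. by move/subge0/orth_ge0; rewrite orthB => /le_of_sub; apply. Qed.

Lemma orth_addZ (t : R) : 0 <= t -> orthomorphism (fun x => A x + t *: x).
Proof.
move=> t0; split=> [a x y|x x0|x y hxy].
- by rewrite orthD orthZ; lin_ring.
- by apply: addge0; [exact: orth_ge0 | exact: scalege0].
- by move/disj_sym: hxy => h; apply/disj_sym/disjD; [exact: orth_disj|exact: disjZ].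
Qed.

(* Pointwise, the value of [lam] where [x1 = lam y1] makes both terms of the
   bound vanish. The values [lam = k e] come within [e] of it, and [h] is
   eliminated on the set [x1 < k e y1] by induction on [k]. *)
Lemma disj_of_dist_bound x1 y1 x2 y2 h :
  le 0 x1 -> le 0 y1 -> le 0 x2 -> le 0 y2 -> le 0 h ->
  (forall lam : R, 0 <= lam ->
     [/\ disj (ppart (x1 - lam *: y1)) (ppart (lam *: y2 - x2)),
         disj (ppart (lam *: y1 - x1)) (ppart (x2 - lam *: y2)) &
         le h (A (vabs (x1 - lam *: y1)) + vabs (x2 - lam *: y2))]) ->
  disj h y1.
Proof.
move=> x10 y10 x20 y20 h0 H.
pose s := A y1 + y2.
have s0 : le 0 s by apply: addge0 => //; exact: orth_ge0.
(* The part of [h] that exceeds [e *: s], the error made by moving one grid step. *)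
pose v (e : R) := ppart (h - e *: s).
have v0 e : le 0 (v e) by exact: ppart_ge0.
have step (e : R) (k : nat) : 0 < e ->
    disj (v e) (ppart ((k%:R * e) *: y1 - x1)) /\
    disj (v e) (ppart ((k%:R * e) *: y2 - x2)).
  move=> e0; elim: k => [|k [IH1 IH2]].
    by split; rewrite mul0r scale0r add0r ppart_le0; try exact: disj0;
      [move/subge0: x10 | move/subge0: x20] => hx; apply: (le_of_sub hx); lin_ring.
  set l := k.+1%:R * e.
  have l0 : 0 <= l by rewrite mulr_ge0 // ltW.
  have [d1 d2 hb] := H l l0.
  have near (x y : F) : le 0 y ->
      le (ppart (l *: y - x)) (ppart ((k%:R * e) *: y - x) + e *: y).
    move=> y0; apply: ppart_le.
      by apply: addge0; [exact: ppart_ge0 | apply: scalege0 => //; exact: ltW].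
    have /subge0 hp := le_ppart ((k%:R * e) *: y - x).
    by apply: (le_of_sub hp); rewrite /l -natr1; lin_ring.
  (* [hb] bounds [h] by the distances at [l], and [near] moves two of their four parts back to the
     previous grid point, where the induction hypothesis applies. The cost [e *: s] is what [v e]
     has subtracted. *)
  pose S := (A (ppart (x1 - l *: y1)) + A (ppart ((k%:R * e) *: y1 - x1))) +
            (ppart (x2 - l *: y2) + ppart ((k%:R * e) *: y2 - x2)).
  have vS : le (v e) S.
    apply: ppart_le.
      by do 2!apply: addge0; try apply: orth_ge0; exact: ppart_ge0.
    have /orth_le/subge0 := near x1 _ y10; rewrite orthD orthZ => n1.
    have /subge0 n2 := near x2 _ y20.
    move/subge0: hb; rewrite /vabs orthD !opprB => hb.
    apply: (le_of_sub (addge0 hb (addge0 n1 n2))); rewrite /S /s; lin_ring.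
  have key j : le 0 j -> le j (v e) -> disj j (ppart (x1 - l *: y1)) ->
      disj j (ppart (x2 - l *: y2)) -> j = 0.
    move=> j0 jv j1 j2; apply/disjxx/disj_sym.
    suff dS : disj j S.
      by apply/(disj_le (disj_sym dS)) => //; exact: vl_trans vS.
    apply: disjD; apply: disjD => //; try apply: orth_disj => //.
      exact: disj_le IH1 _ _.
    exact: disj_le IH2 _ _.
  split; apply: disjP => //; try exact: ppart_ge0.
    move=> j j0 jv jp; apply: key => //.
      by apply: disj_le j0 jp; rewrite -[l *: y1 - x1]opprB; exact/disj_sym/disj_ppart.
    exact: disj_le d2 j0 jp.
  move=> j j0 jv jp; apply: key => //.
    exact: disj_le (disj_sym d1) j0 jp.
  by apply: disj_le j0 jp; rewrite -[l *: y2 - x2]opprB; exact/disj_sym/disj_ppart.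
have vy (e : R) : 0 < e -> disj (v e) y1.
  move=> e0; apply: disjP => // j j0 jv jy.
  suff : e *: j = 0.
    by move/eqP; rewrite scaler_eq0 gt_eqF //= => /eqP.
  (* For every [k], [k e j <= k e y1 <= ppart (k e y1 - x1) + x1], and the positive part drops out
     because it is disjoint from [j]. *)
  apply: (@vl_arch _ x1); first by apply: scalege0 => //; exact: ltW.
  move=> k; rewrite scalerA; set l := _ * e.
  have l0 : 0 <= l by rewrite mulr_ge0 // ltW.
  have [d _] := step e k e0; rewrite -/l in d.
  apply: (@disj_le_add _ (ppart (l *: y1 - x1))) => //.
    by apply/disj_sym/disjZ => //; apply/disj_sym/(disj_le d).
  apply: vl_trans (vl_leZ l0 jy) _.
  have /subge0 hp := le_ppart (l *: y1 - x1).
  by apply: (le_of_sub hp); lin_ring.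
(* [h <= v e + e *: s] and [j] is disjoint from [v e], so [j <= e *: s] for every [e > 0]. *)
apply: disjP => // j j0 jh jy; apply: (vl_arch_eps j0 s0) => e e0.
apply: (@disj_le_add _ (v e)); last first.
- apply: vl_trans jh _; have /subge0 hp := le_ppart (h - e *: s).
  by apply: (le_of_sub hp); rewrite /v; lin_ring.
- by apply: scalege0 => //; exact: ltW.
by apply: (disj_le (disj_sym (vy e e0))).
Qed.

End Orthomorphism.

(** Pointwise, [A] multiplies by a function, which cannot be both above and below [t]. For [j] below
    both parts and [z = x - lam y], one has [j <= (A - t) z <= (A + t) |z|] up to terms disjoint
    from [j]. The grid lemma for [A + t] then makes [j] disjoint from [y], although [j <= t y]. *)
Lemma orth_sign_disj A (t : R) x y : orthomorphism A ->
  0 <= t -> le 0 x -> le 0 y ->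
  disj (ppart (A x - t *: x)) (ppart (t *: y - A y)).
Proof.
move=> hA t0 x0 y0; apply: disjP; [exact: ppart_ge0..|move=> j j0 jx jy].
have hB := orth_addZ hA t0.
suff dj : disj j (t *: y).
  apply: (disj_eq0 dj) => //; first exact: vl_refl.
  apply: vl_trans jy _; apply: ppart_le; first exact: scalege0.
  by apply: (le_of_sub (orth_ge0 hA y0)); lin_ring.
apply: disjZ => //.
apply: (disj_of_dist_bound hB x0 y0 (vl_refl 0) (vl_refl 0) j0) => lam lam0.
rewrite scaler0 subr0 (ppart_le0 (vl_refl 0)); split.
- exact/disj0/ppart_ge0.
- exact/disj0/ppart_ge0.
have -> : vabs 0 = 0 by rewrite /vabs oppr0 (ppart_le0 (vl_refl 0)) addr0.
rewrite addr0; set z := x - lam *: y.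
have d1 : disj j (ppart (t *: x - A x)).
  by apply: (disj_le _ j0 jx); rewrite -[t *: x - A x]opprB; exact: disj_ppart.
have d2 : disj j (ppart (A y - t *: y)).
  by apply: (disj_le _ j0 jy); rewrite -[A y - _]opprB; exact: disj_ppart.
apply: (disj_le_add (disjD d1 (disjZ lam0 d2))).
  exact: (orth_ge0 hB (vabs_ge0 z)).
apply: vl_trans jx _.
have /subge0 h1 := orth_le hA (le_vabs z).
have /subge0 h2 := vl_leZ t0 (le_vabsN z).
have h3 := scalege0 lam0 (ppart_ge0 (t *: y - A y)).
apply: (le_of_sub (addge0 (addge0 h1 h2) h3)).
rewrite -[t *: x - A x]opprB ppartN -[t *: y - _]opprB (ppartN (A y - _)).
rewrite /z (orthB hA) (orthZ hA); lin_ring.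
Qed.

(** Here [lam] plays the pointwise multiplier of [A]: as [B (lam x) = lam B x], the commutator is
    bounded by [B |A x - lam x| + |A (B x) - lam B x|]. Disjointness of [h] from [x] passes to
    [B (A x)], which dominates [h]. *)
Lemma orth_comm_le A B x : orthomorphism A -> orthomorphism B -> le 0 x ->
  le (B (A x)) (A (B x)).
Proof.
move=> hA hB x0.
have Ax0 := orth_ge0 hA x0; have Bx0 := orth_ge0 hB x0.
pose h := ppart (B (A x) - A (B x)).
have h0 : le 0 h := ppart_ge0 _.
suff dj : disj h x.
  have : h = 0.
    apply: (disj_eq0 (orth_disj hB (orth_disj hA dj))) => //; first exact: vl_refl.
    apply: ppart_le; first exact: (orth_ge0 hB Ax0).
    by apply: (le_of_sub (orth_ge0 hA Bx0)); lin_ring.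
  move/ppart_eq0/subge0 => h1; apply: (le_of_sub h1); lin_ring.
apply: (disj_of_dist_bound hB Ax0 x0 (orth_ge0 hA Bx0) Bx0 h0) => lam lam0.
split; first exact: orth_sign_disj.
  exact/disj_sym/orth_sign_disj.
apply: ppart_le; first exact: (addge0 (orth_ge0 hB (vabs_ge0 _)) (vabs_ge0 _)).
have /subge0 h1 := orth_le hB (le_vabs (A x - lam *: x)).
have /subge0 h2 := le_vabsN (A (B x) - lam *: B x).
apply: (le_of_sub (addge0 h1 h2)); rewrite (orthB hB) (orthZ hB); lin_ring.
Qed.

Lemma orth_comm A B x : orthomorphism A -> orthomorphism B -> le 0 x ->
  B (A x) = A (B x).
Proof.
move=> hA hB x0.
exact: (vl_anti (orth_comm_le hA hB x0) (orth_comm_le hB hA x0)).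
Qed.

End VectorLattice.

(** * Commutativity of semiprime f-algebras *)

Section FAlgebra.
Variables (R : realType) (F : lmodType R) (le : F -> F -> Prop).
Hypothesis hVL : is_vector_lattice le.
Variable mul : F -> F -> F.
Hypotheses (hfA : is_f_algebra le mul) (hsp : semiprime mul).

Lemma falg_orth z : le 0 z -> orthomorphism le (mul^~ z).
Proof.
case: hfA => _ hl _ hp hd z0; split=> [a x y|x x0|x y hxy].
- exact: hl.
- exact: hp.
- by case: (hd x y z hxy z0).
Qed.

Lemma falg_mulBl x y z : mul (x - y) z = mul x z - mul y z.
Proof.
by case: hfA => _ hl _ _ _; rewrite -scaleN1r addrC hl scaleN1r addrC.
Qed.

Lemma falg_mulBr x y z : mul z (x - y) = mul z x - mul z y.
Proof.
by case: hfA => _ _ hr _ _; rewrite -scaleN1r addrC hr scaleN1r addrC.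
Qed.

Lemma falg_reduced x : mul x x = 0 -> x = 0.
(* The index [1] is the square, since [fpow mul x n] has exponent [n + 1]. *)
Proof. by move=> h; apply: (hsp (n := 1)). Qed.

(* Right multiplications by positive elements commute, so [x (w z - z w) = 0]
   for every [x]; take [x = w z - z w]. *)
Lemma falg_mulC x y : mul x y = mul y x.
Proof.
have mulA : forall x y z, mul x (mul y z) = mul (mul x y) z by case: hfA.
have pos2 w z : le 0 w -> le 0 z -> mul w z = mul z w.
  move=> w0 z0; apply/eqP; rewrite -subr_eq0; apply/eqP/falg_reduced.
  have h x' : le 0 x' -> mul x' (mul w z - mul z w) = 0.
    move=> x0; rewrite falg_mulBr !mulA; apply/eqP; rewrite subr_eq0; apply/eqP.
    exact: (orth_comm hVL (falg_orth w0) (falg_orth z0) x0).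
  set c := _ - _ in h *; rewrite {1}(ppart_decomp hVL c) falg_mulBl.
  by rewrite !h ?subr0 //; exact: ppart_ge0.
have p0 := ppart_ge0 hVL.
rewrite (ppart_decomp hVL x) (ppart_decomp hVL y) !falg_mulBl !falg_mulBr.
rewrite !(pos2 (ppart le x)) // !(pos2 (ppart le (- x))) //.
lin_ring.
Qed.

Lemma falg_comm_mul : {m : comm_mul F | cmul m = mul}.
Proof.
by case: hfA => hA hl _ _ _; exists (CommMul hA falg_mulC hl).
Qed.

End FAlgebra.

(** * Squares, products and infima in a commutative semiprime f-algebra *)

Section CommutativeFAlgebra.
Variables (R : realType) (F : lmodType R) (le : F -> F -> Prop).
Hypothesis hVL : is_vector_lattice le.
Variable m : comm_mul F.
Hypotheses (hfA : is_f_algebra le m) (hsp : semiprime m).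
Local Notation ppart := (ppart le).
Local Notation disj := (disj le).
Local Notation le_of_sub := (le_of_sub hVL).
Local Notation subge0 := (subge0 hVL).
Local Notation addge0 := (addge0 hVL).
Local Notation scalege0 := (scalege0 hVL).

Lemma mulge0 x y : le 0 x -> le 0 y -> le 0 (m x y).
Proof. by case: hfA => _ _ _ + _; apply. Qed.

Lemma cmul0r x : m x 0 = 0.
Proof. by rewrite cmulC cmul0l. Qed.

Lemma leM2l x y z : le 0 z -> le x y -> le (m z x) (m z y).
Proof.
by move=> z0 /subge0 h; apply: (le_of_sub (mulge0 z0 h)); alg_ring m.
Qed.

(** Multiplying [x] by [y], then [y] by [x], preserves disjointness, so [m x y] is disjoint from
    itself. *)
Lemma disj_mul x y : disj x y -> m x y = 0.
Proof.
case: hfA => _ _ _ _ hd h; have x0 := disj_ge0l h; have y0 := disj_ge0r h.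
have [h1 _] := hd _ _ _ h y0; have [_ h2] := hd _ _ _ h1 x0.
by apply: (disjxx hVL); rewrite {2}cmulC.
Qed.

Lemma disjMr x y z : le 0 z -> disj x y -> disj x (m z y).
Proof. by case: hfA => _ _ _ _ hd z0 h; rewrite cmulC; case: (hd _ _ _ h z0). Qed.

(** Any [j >= 0] below both satisfies [j^2 <= x y = 0]. *)
Lemma mul_eq0_disj x y : le 0 x -> le 0 y -> m x y = 0 -> disj x y.
Proof.
move=> x0 y0 h; apply: (disjP hVL) => // j j0 jx jy.
apply: (falg_reduced hsp); apply: (le0_anti hVL); first exact: mulge0.
apply: (vl_trans hVL (leM2l j0 jy)).
by rewrite -h cmulC [m x y]cmulC; exact: leM2l.
Qed.

Lemma ppart_mulN x : m (ppart x) (ppart (- x)) = 0.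
Proof. exact/disj_mul/(disj_ppart hVL). Qed.

Lemma ppart_mul x : m (ppart x) x = m (ppart x) (ppart x).
Proof.
rewrite {2}(ppart_decomp hVL x); transitivity (m (ppart x) (ppart x) - m (ppart x) (ppart (- x))).
  alg_ring m.
by rewrite ppart_mulN subr0.
Qed.

Lemma sq_ge0 x : le 0 (m x x).
Proof.
have -> : m x x = m (ppart x) (ppart x) + m (ppart (- x)) (ppart (- x)) -
                  2 *: m (ppart x) (ppart (- x)).
  by rewrite {1 2}(ppart_decomp hVL x); alg_ring m.
rewrite ppart_mulN scaler0 subr0.
by apply: addge0; apply: mulge0; exact: ppart_ge0.
Qed.

(** For [z = x - y], the relation [z (x + y) = 0] gives [z^2 = 2 z x = - 2 z y], whence
    [z^4 = - 4 z^2 x y <= 0] and [z] is nilpotent. *)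
Lemma sq_inj x y : le 0 x -> le 0 y -> m x x = m y y -> x = y.
Proof.
move=> x0 y0 h; apply/eqP; rewrite -subr_eq0; apply/eqP; set z := x - y.
have z1 : m z (x + y) = 0.
  by transitivity (m x x - m y y); [alg_ring m | rewrite h subrr].
have zz : m z z = 2 *: m z x.
  by transitivity (2 *: m z x - m z (x + y)); [rewrite /z; alg_ring m | rewrite z1 subr0].
have zz' : m z z = - (2 *: m z y).
  by transitivity (- (2 *: m z y) + m z (x + y)); [rewrite /z; alg_ring m | rewrite z1 addr0].
apply/(falg_reduced hsp)/(falg_reduced hsp)/(le0_anti hVL); first exact: sq_ge0.
have h0 : le 0 (4 *: m (m z z) (m x y)).
  by apply: scalege0 => //; apply: mulge0; [exact: sq_ge0 | exact: mulge0].
apply: (le_of_sub h0); rewrite sub0r.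
transitivity (- m (2 *: m z x) (- (2 *: m z y))); first by rewrite -zz -zz'.
by alg_ring m.
Qed.

(* Pointwise, [lam = g / a] makes the bound vanish wherever [a <> 0]; the values
   [lam = k e] come within [e] of it. *)
Lemma mul_eq0_of_sq_dist w a g : le 0 w -> le 0 a -> le 0 g ->
  (forall lam : R, 0 <= lam -> le w (m (lam *: a - g) (lam *: a - g))) ->
  m w a = 0.
Proof.
move=> w0 a0 g0 H.
have p0 := ppart_ge0 hVL.
pose v (e : R) := ppart (w - e ^+ 2 *: m a a).
have step (e : R) (k : nat) : 0 < e -> m (v e) (ppart ((k%:R * e) *: a - g)) = 0.
  move=> e0; elim: k => [|k IH].
    rewrite mul0r scale0r add0r ppart_le0 ?cmul0r //.
    by apply: (le_of_sub g0); lin_ring.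
  set l := k.+1%:R * e; set p := ppart (l *: a - g).
  have l0 : 0 <= l by rewrite mulr_ge0 // ltW.
  have vp : le (m (v e) p) (e *: m (v e) a).
    have : le p (ppart ((k%:R * e) *: a - g) + e *: a).
      apply: (ppart_le hVL); first by apply: addge0 => //; apply: scalege0 => //; exact: ltW.
      have /subge0 h := le_ppart hVL ((k%:R * e) *: a - g).
      by apply: (le_of_sub h); rewrite /l -natr1; lin_ring.
    by move/(leM2l (p0 (w - e ^+ 2 *: m a a))); rewrite cmulDr -/(v e) IH add0r cmulZr.
  have q0 : le 0 (m (v e) p) by apply: mulge0; exact: p0.
  have vpw : le (m (m (v e) p) w) (m (m (m (v e) p) p) p).
    have := leM2l q0 (H l l0).
    have -> : m (m (v e) p) (m (l *: a - g) (l *: a - g)) =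
              m (m (v e) (m p (l *: a - g))) (l *: a - g) by alg_ring m.
    rewrite ppart_mul -/p.
    have -> : m (m (v e) (m p p)) (l *: a - g) = m (m (v e) p) (m p (l *: a - g)).
      by alg_ring m.
    by rewrite ppart_mul -/p cmulA.
  have vpp : le (m (m (v e) p) p) (e *: m a (m (v e) p)).
    have /subge0 h := leM2l (p0 (l *: a - g)) vp.
    by apply: (le_of_sub h); rewrite -/p; alg_ring m.
  have vppp : le (m (m (m (v e) p) p) p) (e ^+ 2 *: m (m a a) (m (v e) p)).
    have /subge0 h1 := leM2l (p0 (l *: a - g)) vpp.
    have /subge0 h2 := vl_leZ hVL (ltW e0) (leM2l a0 vpp).
    by apply: (le_of_sub (addge0 h1 h2)); rewrite -/p; alg_ring m.
  (* Since [v (w - e^2 a^2) = v^2] by [ppart_mul], the bounds [vpw] and [vppp] together say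
     [v^2 p <= 0]. *)
  have vvp : m (m (v e) (v e)) p = 0.
    apply: (le0_anti hVL); first by apply: mulge0; [apply: sq_ge0 | exact: p0].
    rewrite -ppart_mul -/(v e).
    have /subge0 h := vl_trans hVL vpw vppp.
    by apply: (le_of_sub h); alg_ring m.
  apply: (falg_reduced hsp); transitivity (m (m (m (v e) (v e)) p) p).
    by alg_ring m.
  by rewrite vvp cmul0l.
have va (e : R) : 0 < e -> m (v e) a = 0.
  move=> e0; suff : e *: m (v e) a = 0.
    by move/eqP; rewrite scaler_eq0 gt_eqF //= => /eqP.
  apply: (@vl_arch _ _ _ hVL _ (m (v e) g)).
    by apply: scalege0; [exact: ltW | apply: mulge0 => //; exact: p0].
  move=> k; have := leM2l (p0 (w - e ^+ 2 *: m a a)) (le_ppart hVL ((k%:R * e) *: a - g)).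
  rewrite -/(v e) step // => /subge0 h; apply: (le_of_sub h); alg_ring m.
apply: (@vl_arch_eps _ _ _ hVL _ (m a (m a a))); [exact: mulge0| |].
  by apply: mulge0 => //; exact: mulge0.
(* The grid step [sqrt e] turns the quadratic error into the linear one that [vl_arch_eps]
   expects. *)
move=> e e0; have s0 : 0 < Num.sqrt e by rewrite sqrtr_gt0.
have /subge0 h := leM2l a0 (le_ppart hVL (w - Num.sqrt e ^+ 2 *: m a a)).
rewrite -/(v (Num.sqrt e)) (cmulC _ a (v _)) va // sqr_sqrtr ?ltW // in h.
by apply: (le_of_sub h); alg_ring m.
Qed.

(** The hypothesis at [t = lam], multiplied by [lam a], gives [g^2 - a b <= (lam a - g)^2], so the
    positive part [w] of [g^2 - a b] annihilates [a]. Letting [t] grow, it also annihilates [g];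
    hence [w^2 = w (g^2 - a b) = 0]. *)
Lemma gm_sq_le a b g : le 0 a -> le 0 b -> le 0 g ->
  (forall t : R, 0 < t -> le (2 *: g) (t *: a + t^-1 *: b)) ->
  le (m g g) (m a b).
Proof.
move=> a0 b0 g0 H; have p0 := ppart_ge0 hVL.
pose w := ppart (m g g - m a b); have w0 : le 0 w := p0 _.
have wa : m w a = 0.
  apply: (mul_eq0_of_sq_dist w0 a0 g0) => lam; rewrite le_eqVlt => /orP[/eqP<-|l0].
    rewrite scale0r add0r; apply: (ppart_le hVL); first exact: sq_ge0.
    by apply: (le_of_sub (mulge0 a0 b0)); alg_ring m.
  apply: (ppart_le hVL); first exact: sq_ge0.
  have /subge0 h := vl_leZ hVL (ltW l0) (leM2l a0 (H _ l0)).
  rewrite cmulDr scalerDr [m a (lam^-1 *: b)]cmulZr [lam *: (lam^-1 *: _)]scalerA in h.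
  by rewrite divff ?gt_eqF // scale1r in h; apply: (le_of_sub h); alg_ring m.
have wg : m w g = 0.
  apply: (@vl_arch_eps _ _ _ hVL _ (m w b)); [exact: mulge0..|move=> e e0].
  have := H e^-1; rewrite invr_gt0 invrK => /(_ e0)/(leM2l w0).
  rewrite cmulDr !cmulZr wa scaler0 add0r.
  move/subge0 => h.
  by apply: (le_of_sub (addge0 (mulge0 w0 g0) h)); alg_ring m.
have w1 : w = 0.
  apply: (falg_reduced hsp); rewrite -ppart_mul -/w.
  transitivity (m (m w g) g - m (m w a) b); first by alg_ring m.
  by rewrite wg wa !cmul0l subr0.
by move/(ppart_eq0 hVL): w1 => /subge0 h; apply: (le_of_sub h); lin_ring.
Qed.

(** Order continuity of multiplication by [s]. The positive part [w] of [l] lies below every [s d];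
    [key] at [c = e s] yields [s w <= e s^3], so [s w = 0] and [w^2 <= w s d = 0]. *)
Lemma mul_inf0 (D : F -> Prop) s l : le 0 s -> is_inf le D 0 ->
  (forall d, D d -> le l (m s d)) -> le l 0.
Proof.
move=> s0 [D0 Dinf] H; have p0 := ppart_ge0 hVL.
apply: (ppart_eq0 hVL); set w := ppart l; have w0 : le 0 w := p0 _.
have Hw d : D d -> le w (m s d).
  by move=> hd; apply: (ppart_le hVL); [apply: mulge0 => //; exact: D0 | exact: H].
have key c : le 0 c -> disj c (ppart (w - m s c)).
  move=> c0; set k := ppart _; apply: (disjP hVL) => // [|j j0 jc jk]; first exact: p0.
  apply: (le0_anti hVL) => //; apply: Dinf => d hd.
  (* where [k > 0], [w > s c], hence [d > c >= j] *)
  set n := ppart (c - d).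
  have kn : disj n k.
    apply: mul_eq0_disj; [exact: p0..|].
    (* [k^2 n = k n (w - s c) <= k n s (d - c) = - k s n^2]. *)
    have kkn : m (m k k) n = 0.
      apply: (le0_anti hVL); first by apply: mulge0; [exact: sq_ge0 | exact: p0].
      rewrite -ppart_mul -/k.
      have h1 : le 0 (m (m k n) (m s d - w)).
        by apply: mulge0; [apply: mulge0; exact: p0 | exact/subge0/Hw].
      have h2 : le 0 (m (m k s) (m n n)).
        by apply: mulge0; [apply: mulge0 => //; exact: p0 | exact: sq_ge0].
      apply: (le_of_sub (addge0 h1 h2)); rewrite -ppart_mul -/n; alg_ring m.
    apply: (falg_reduced hsp); transitivity (m (m (m k k) n) n); first by alg_ring m.
    by rewrite kkn cmul0l.
  suff /subge0 h : le (j - d) 0 by apply: (le_of_sub h); lin_ring.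
  apply: (disj_le0 kn).
    apply: (vl_trans hVL) (le_ppart hVL _); move/subge0: jc => h.
    by apply: (le_of_sub h); lin_ring.
  apply: (vl_trans hVL) jk; apply: (le_of_sub (D0 _ hd)); lin_ring.
have sw : m s w = 0.
  apply: (@vl_arch_eps _ _ _ hVL _ (m s (m s s))); first exact: mulge0.
    by apply: mulge0 => //; exact: sq_ge0.
  move=> e e0; have := disj_mul (key _ (scalege0 (ltW e0) s0)).
  rewrite cmulZl => /eqP; rewrite scaler_eq0 gt_eqF //= => /eqP sk.
  have := leM2l s0 (le_ppart hVL (w - m s (e *: s))); rewrite sk => /subge0 h.
  by apply: (le_of_sub h); alg_ring m.
apply: (le0_anti hVL) => //; apply: Dinf => d hd; suff -> : w = 0 by exact: D0.
apply: (falg_reduced hsp); apply: (le0_anti hVL); first exact: mulge0.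
have := leM2l w0 (Hw d hd).
by rewrite cmulA (cmulC _ w s) sw cmul0l.
Qed.

(* If [X <= a + b] the bound follows from [X ^ 2 >= 4 a b], otherwise from
   [(a + b - 2 g) ^ 2 + (a - b) ^ 2 >= 0]; [pos] and [neg] below are the two
   cases. *)
Lemma gm_defect_bound a b g X : le 0 a -> le 0 b ->
  le (2 *: g) (a + b) -> le (2 *: g) X -> le (4 *: m a b) (m X X) ->
  le (2 *: (m a b - m g g)) (m (a + b) (X - 2 *: g)).
Proof.
move=> a0 b0 /subge0 gs /subge0 gX /subge0 hX; have p0 := ppart_ge0 hVL.
have s0 := addge0 a0 b0.
set s := a + b; pose Y := 2 *: m s (X - 2 *: g) - 4 *: (m a b - m g g).
have neg : le (- Y) (2 *: m s (ppart (s - X))).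
  have h1 := sq_ge0 (s - 2 *: g); have h2 := sq_ge0 (a - b).
  have /subge0 h3 := vl_leZ hVL (ler0n R 2) (leM2l s0 (le_ppart hVL (s - X))).
  by apply: (le_of_sub (addge0 (addge0 h1 h2) h3)); rewrite /Y /s; alg_ring m.
have pos : le (- Y) (m (X - 2 *: g) (ppart (X - s))).
  have h1 := mulge0 gX gs.
  have /subge0 h2 := leM2l gX (le_ppart hVL (X - s)).
  by apply: (le_of_sub (addge0 (addge0 h1 h2) hX)); rewrite /Y /s; alg_ring m.
have dj : disj (2 *: m s (ppart (s - X))) (m (X - 2 *: g) (ppart (X - s))).
  apply: disjMr => //; apply/disj_sym/(disjZ hVL) => //; apply: disjMr => //.
  by rewrite -[s - X]opprB; exact: disj_ppart.
have /subge0 h := disj_le0 dj neg pos.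
have h2 : le 0 (2^-1 *: (0 - - Y)) by apply: scalege0; rewrite ?invr_ge0.
apply: (le_of_sub h2); rewrite sub0r opprK /Y [RHS]scalerBr !scalerA.
have -> : 2^-1 * 2 = 1 :> R by field.
have -> : 2^-1 * 4 = 2 :> R by field.
by rewrite scale1r.
Qed.

(** One half is [gm_sq_le]. For the other, [gm_defect_bound] puts [2 (a b - g^2)] below
    [(a + b) (X - 2 g)] for each [X] in [gm_set a b], and the differences [X - 2 g] have infimum
    [0]. *)
Lemma gm_sq a b g : le 0 a -> le 0 b -> le 0 g ->
  is_inf le (gm_set a b) (2 *: g) -> m g g = m a b.
Proof.
move=> a0 b0 g0 [glb ginf].
have H (t : R) : 0 < t -> le (2 *: g) (t *: a + t^-1 *: b).
  by move=> t0; apply: glb; exists t.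
apply: (vl_anti hVL); first exact: gm_sq_le.
have ab1 : le (2 *: g) (a + b) by have := H 1 ltr01; rewrite invr1 !scale1r.
suff /subge0 h : le (2 *: (m a b - m g g)) 0.
  have h2 : le 0 (2^-1 *: (0 - 2 *: (m a b - m g g))).
    by apply: scalege0; rewrite ?invr_ge0.
  apply: (le_of_sub h2); rewrite sub0r scalerN scalerA mulVf ?pnatr_eq0 // scale1r.
  by lin_ring.
pose D d := exists2 X, gm_set a b X & d = X - 2 *: g.
apply: (@mul_inf0 D (a + b)); first exact: addge0.
  split=> [d [X hX ->]|l hl]; first exact/subge0/glb.
  suff /subge0 h : le (l + 2 *: g) (2 *: g) by apply: (le_of_sub h); lin_ring.
  apply: ginf => X hX; have /subge0 h : le l (X - 2 *: g) by apply: hl; exists X.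
  by apply: (le_of_sub h); lin_ring.
move=> d [X [t [t0 XE]] ->]; apply: gm_defect_bound => //; first by rewrite XE; exact: H.
(* [X^2 - 4 a b = (t a - t^-1 b)^2]. *)
apply: (le_of_sub (sq_ge0 (t *: a - t^-1 *: b))).
have E (c : F) : t *: (t^-1 *: c) = c by rewrite scalerA divff ?gt_eqF // scale1r.
rewrite -{1}(E (m a b)) XE; alg_ring m.
Qed.

(** * The geometric mean and the infimum over [lam] *)

Hypothesis hgm : gm_closed le.

Lemma boxtimes_inf a b : le 0 a -> le 0 b ->
  is_inf le (gm_set a b) (2 *: boxtimes le a b).
Proof.
move=> a0 b0; rewrite /boxtimes scalerA divff ?pnatr_eq0 // scale1r.
by apply: epsilon_spec; exact: hgm.
Qed.

Lemma boxtimes_ge0 a b : le 0 a -> le 0 b -> le 0 (boxtimes le a b).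
Proof.
move=> a0 b0; have [_ h] := boxtimes_inf a0 b0.
have /(scalege0 (_ : 0 <= 2^-1)) : le 0 (2 *: boxtimes le a b).
  apply: h => X [t [t0 ->]].
  by apply: addge0; apply: scalege0; rewrite ?invr_ge0 ?ltW.
by rewrite scalerA mulVf ?pnatr_eq0 // scale1r invr_ge0 ler0n; apply.
Qed.

Lemma boxtimes_sq a b : le 0 a -> le 0 b ->
  m (boxtimes le a b) (boxtimes le a b) = m a b.
Proof.
by move=> a0 b0; apply: gm_sq => //; [exact: boxtimes_ge0 | exact: boxtimes_inf].
Qed.

(** [m p q] and the geometric mean of the squares are positive with equal squares, so [sq_inj]
    identifies them. *)
Lemma gm_sq_inf p q : le 0 p -> le 0 q ->
  is_inf le (gm_set (m p p) (m q q)) (2 *: m p q).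
Proof.
move=> p0 q0.
have -> : m p q = boxtimes le (m p p) (m q q); last exact/boxtimes_inf/sq_ge0/sq_ge0.
apply: sq_inj; [exact: mulge0|exact: boxtimes_ge0 (sq_ge0 p) (sq_ge0 q)|].
by rewrite (boxtimes_sq (sq_ge0 p) (sq_ge0 q)); alg_ring m.
Qed.

(** The bracket is the expansion of [||lam x - y||^2], with [c] standing for [T(x,y) u]. *)
Lemma inf_sub_vabs p q (c : F) : le 0 p -> le 0 q ->
  is_inf le (fun w => exists lam : R, lam != 0 /\
    w = `|lam|^-1 *: (lam ^+ 2 *: m p p - (2 * lam) *: c + m q q))
  (2 *: m p q - 2 *: vabs le c).
Proof.
move=> p0 q0; have [glb ginf] := gm_sq_inf p0 q0.
have E (t : R) : 0 < t ->
    t^-1 *: (t ^+ 2 *: m p p - (2 * t) *: c + m q q) =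
    t *: m p p + t^-1 *: m q q - 2 *: c /\
    t^-1 *: ((- t) ^+ 2 *: m p p - (2 * - t) *: c + m q q) =
    t *: m p p + t^-1 *: m q q + 2 *: c.
  move=> t0; have tn : t != 0 by rewrite gt_eqF.
  have e1 : t^-1 * t ^+ 2 = t by field.
  have e2 : t^-1 * (2 * t) = 2 by field.
  by rewrite sqrrN mulrN scaleNr opprK !scalerDr scalerN !scalerA e1 e2; split; lin_ring.
have h2 := ler0n R 2.
split=> [_ [lam [lam0 ->]]|l hl].
  have n0 : 0 < `|lam| by rewrite normr_gt0.
  have [E1 E2] := E _ n0.
  have /subge0 h : le (2 *: m p q) (`|lam| *: m p p + `|lam|^-1 *: m q q).
    by apply: glb; exists `|lam|.
  case: (ger0P lam) (E1) (E2) h => _ F1 F2 h.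
    have /subge0 hc := vl_leZ hVL h2 (le_vabs hVL c).
    by apply: (le_of_sub (addge0 h hc)); rewrite F1; lin_ring.
  have /subge0 hc := vl_leZ hVL h2 (le_vabsN hVL c).
  by rewrite opprK in F2; apply: (le_of_sub (addge0 h hc)); rewrite F2; lin_ring.
suff /subge0 h : le (l + 2 *: vabs le c) (2 *: m p q) by apply: (le_of_sub h); lin_ring.
apply: ginf => _ [t [t0 ->]]; have [E1 E2] := E t t0.
have tn : t != 0 by rewrite gt_eqF.
have /subge0 l1 : le l (t *: m p p + t^-1 *: m q q - 2 *: c).
  by apply: hl; exists t; rewrite gtr0_norm.
have /subge0 l2 : le l (t *: m p p + t^-1 *: m q q + 2 *: c).
  by apply: hl; exists (- t); rewrite normrN gtr0_norm // oppr_eq0.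
set X := t *: m p p + t^-1 *: m q q in l1 l2 *.
(* As [2 |c| = 4 c^+ - 2 c], the goal reads [4 c^+ <= X + 2 c - l]; [l2] and [l1] put [0] and [4 c]
   below the right side. *)
have /(ppart_le hVL) h : le 0 (4^-1 *: (X + 2 *: c - l)).
  by apply: scalege0; rewrite // invr_ge0.
have /h/(vl_leZ hVL (ler0n R 4)) : le c (4^-1 *: (X + 2 *: c - l)).
  apply: (@le_of_sub _ _ (4^-1 *: (X - 2 *: c - l))).
    by apply: scalege0; rewrite // invr_ge0.
  transitivity (4^-1 *: (X + 2 *: c - l) - 4^-1 *: (4 *: c)); last by lin_ring.
  by rewrite [4^-1 *: (4 *: c)]scalerA mulVf ?pnatr_eq0 // scale1r.
rewrite scalerA divff ?pnatr_eq0 // scale1r => /subge0 h'.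
by apply: (le_of_sub h'); rewrite /vabs (ppartN hVL); lin_ring.
Qed.

End CommutativeFAlgebra.

(** * Expansion of the squared seminorms and the defect in the triangle inequality *)

Theorem theorem3p5 (R : realType) (F : lmodType R) (le : F -> F -> Prop)
  (mul : F -> F -> F)
  (hVL : is_vector_lattice le) (hfA : is_f_algebra le mul)
  (hsp : semiprime mul) (hgm : gm_closed le)
  (V : lmodType R) (T : V -> V -> F) (hT : is_vsip le T)
  (u : F) (hu : le 0 u) (x y : V) :
  let N := Tnorm le T u in
  let sq := fun a : F => mul a a in
  exists m : F,
    is_inf le (fun w => exists lam : R, lam != 0 /\
                 w = `|lam|^-1 *: sq (N (lam *: x - y))) m /\
    le (sq (N (x + y))) (sq (N x + N y) - m) /\
    le (sq (N x + N y) - m) (sq (N x + N y)) /\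
    (sq (N (x + y)) = sq (N x + N y) - m <-> le 0 (mul (T x y) u)).
Proof.
have [m mE] := falg_comm_mul hVL hfA hsp; subst mul.
case: hT => Tl Tr Tsym Tpos N sq.
have N0 z : le 0 (N z) by exact: boxtimes_ge0.
have NE z : sq (N z) = m (T z z) u by exact: boxtimes_sq.
set p := N x; set q := N y; set c := m (T x y) u.
(* General coefficients serve both [x + y] and [lam x - y]. *)
have NlE (l e : R) :
    sq (N (l *: x + e *: y)) = l ^+ 2 *: sq p + (2 * l * e) *: c + e ^+ 2 *: sq q.
  have T0l z : T 0 z = 0.
    by apply: (addIr (T 0 z)); have := Tl 1 0 0 z; rewrite scaler0 scale1r !add0r.
  have T0r z : T z 0 = 0 by rewrite Tsym.
  have TZ z : T z (e *: y) = e *: T z y by rewrite -[e *: y]addr0 Tr T0r addr0.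
  have TZ' z : T (e *: y) z = e *: T y z by rewrite Tsym TZ Tsym.
  rewrite !NE Tl !Tr !TZ' !TZ Tsym [T y x]Tsym /c; alg_ring m.
have pqE : sq (p + q) = sq p + 2 *: m p q + sq q by rewrite /sq; alg_ring m.
have NDE : sq (N (x + y)) = sq p + 2 *: c + sq q.
  by have := NlE 1 1; rewrite !scale1r => ->; rewrite !expr1n !mulr1 !scale1r.
have NBE l : sq (N (l *: x - y)) = l ^+ 2 *: sq p - (2 * l) *: c + sq q.
  by have := NlE l (-1); rewrite scaleN1r => ->; rewrite sqrrN expr1n scale1r mulrN1 scaleNr.
have Minf := inf_sub_vabs hVL hfA hsp hgm c (N0 x) (N0 y).
set M := 2 *: m p q - 2 *: vabs le c.
(* The defect is [2 |c| - 2 c], four times the negative part of [c]; it is nonnegative and vanishes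
   exactly when [c >= 0]. *)
have ND : sq (p + q) - M - sq (N (x + y)) = 4 *: ppart le (- c).
  by rewrite pqE NDE /M /vabs (ppartN hVL); lin_ring.
exists M; split; last split; last split.
- case: Minf => lb glb; split=> [_ [l [l0 ->]]|z hz].
    by apply: lb; exists l; rewrite NBE.
  by apply: glb => _ [l [l0 ->]]; apply: hz; exists l; rewrite NBE.
- by apply: (le_of_sub hVL _ ND); apply: scalege0 => //; exact: ppart_ge0.
(* [0] is a lower bound of the family, since its members are positive multiples of squares. *)
- have M0 : le 0 M.
    case: Minf => _; apply=> _ [l [l0 ->]]; apply: scalege0; rewrite ?invr_ge0 //.
    by have := sq_ge0 hVL hfA (N (l *: x - y)); rewrite -/(sq _) NBE.
  by apply: (le_of_sub hVL M0); lin_ring.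
split=> [h|c0].
  move: ND; rewrite h subrr => /esym/eqP; rewrite scaler_eq0 pnatr_eq0 /= => /eqP.
  move/(ppart_eq0 hVL)/(subge0 hVL) => h0; apply: (le_of_sub hVL h0); lin_ring.
apply/esym/eqP; rewrite -subr_eq0 ND; apply/eqP.
rewrite (ppart_le0 hVL) ?scaler0 //; apply: (le_of_sub hVL c0); lin_ring.
Qed.
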